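(* Let $S$ be a $\mathrm{Cu}$-semigroup, and let $T_0\subseteq S$ be a countably based sub-$\mathrm{Cu}$-semigroup. Then there exists a countably based sub-$\mathrm{Cu}$-semigroup $T\subseteq S$ such that $T_0\subseteq T$ and $\dim(T)\leq\dim(S)$.
   Context: Way-below relation: in a partially ordered set, $x\ll y$ means that for every increasing sequence $(z_n)_n$ that has a supremum $z$ with $y\leq z$ there exists $n$ with $x\leq z_n$. A $\mathrm{Cu}$-semigroup is an abelian monoid $S$ with a partial order such that $0\leq x$ for all $x$, and $x\leq y$ implies $x+z\leq y+z$, satisfying: (O1) every increasing sequence has a supremum; (O2) every element is the supremum of a $\ll$-increasing sequence (i.e. $x_n\ll x_{n+1}$ for all $n$); (O3) $x'\ll x$ and $y'\ll y$ imply $x'+y'\ll x+y$; (O4) $\sup_n x_n+\sup_n y_n=\sup_n(x_n+y_n)$ for increasing sequences $(x_n)_n,(y_n)_n$. A $\mathrm{Cu}$-morphism is an order-preserving monoid morphism between $\mathrm{Cu}$-semigroups that preserves suprema of increasing sequences and the way-below relation. A submonoid $T\subseteq S$ is a sub-$\mathrm{Cu}$-semigroup if $T$ is a $\mathrm{Cu}$-semigroup with respect to the order induced by $S$ and the inclusion map $T\to S$ is a $\mathrm{Cu}$-morphism. A subset $B\subseteq S$ is a basis if for all $x',x\in S$ with $x'\ll x$ there exists $y\in B$ with $x'\ll y\ll x$; $S$ is countably based if it has a countable basis. Dimension (with $\mathbb{N}=\{0,1,2,\ldots\}$): for a $\mathrm{Cu}$-semigroup $S$ and $n\in\mathbb{N}$,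 write $\dim(S)\leq n$ if, whenever $x'\ll x\ll y_1+\ldots+y_r$ in $S$, there exist $z_{j,k}\in S$ for $j=1,\ldots,r$ and $k=0,\ldots,n$ such that (i) $z_{j,k}\ll y_j$ for all $j,k$; (ii) $x'\ll\sum_{j,k}z_{j,k}$; (iii) $\sum_{j=1}^r z_{j,k}\ll x$ for each $k=0,\ldots,n$. Then $\dim(S)$ is the smallest such $n$, and $\dim(S)=\infty$ if no such $n$ exists. *)

(* Defs.v *)
From HB Require Import structures.
From mathcomp Require Import all_boot all_order ssralg.
Import Order.TTheory GRing.Theory.

(* Abelian monoids that are also partially ordered sets; the compatibility of
   the order with the addition is part of [cu_semigroup] below.  Hierarchy
   Builder accepts this join only while [Num.POrderedZmodule] is not in scope,
   so it has to precede the remaining imports. *)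
#[short(type="porderNmodType")]
HB.structure Definition POrderedNmodule d :=
  { S of Order.isPOrder d S & GRing.Nmodule S }.

From mathcomp Require Import all_algebra.
From mathcomp Require Import boolp classical_sets cardinality constructive_ereal.

Set Implicit Arguments.
Unset Strict Implicit.
Unset Printing Implicit Defensive.
Import Num.Theory.

Local Open Scope classical_set_scope.
Local Open Scope ring_scope.

Section CuSemigroups.
Variables (d : Order.disp_t) (S : porderNmodType d).
Implicit Types (x y z s t : S) (u v : nat -> S).

(* "Increasing" is meant in the weak sense. *)
Definition increasing u : Prop := {homo u : m n / (m <= n)%N >-> (m <= n)%O}.

Definition is_sup u s : Prop := supremums (range u) s.

Definition way_below x y : Prop :=
  forall u z, increasing u -> is_sup u z -> (y <= z)%O ->
  exists n, (x <= u n)%O.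

Record cu_semigroup : Prop := CuSemigroup {
  cu_ge0 : forall x, (0 <= x)%O;
  cu_leD2r : forall x y z, (x <= y)%O -> (x + z <= y + z)%O;
  cu_O1 : forall u, increasing u -> exists s, is_sup u s;
  cu_O2 : forall x, exists u,
    (forall n, way_below (u n) (u n.+1)) /\ is_sup u x;
  cu_O3 : forall x' x y' y,
    way_below x' x -> way_below y' y -> way_below (x' + y') (x + y);
  cu_O4 : forall u v s t, increasing u -> increasing v ->
    is_sup u s -> is_sup v t -> is_sup (fun n => u n + v n) (s + t) }.

Definition is_basis (B : set S) : Prop :=
  forall x' x, way_below x' x ->
    exists y, [/\ B y, way_below x' y & way_below y x].

Definition countably_based : Prop :=
  exists B : set S, countable B /\ is_basis B.

Definition cu_dim_le (n : nat) : Prop :=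
  forall (r : nat) (x' x : S) (y : 'I_r -> S), (0 < r)%N ->
    way_below x' x -> way_below x (\sum_(j < r) y j) ->
  exists z : 'I_r -> 'I_n.+1 -> S,
    [/\ forall j k, way_below (z j k) (y j),
        way_below x' (\sum_(j < r) \sum_(k < n.+1) z j k)
      & forall k, way_below (\sum_(j < r) z j k) x].

(* The value lies in the naturals extended by +oo, seen inside [\bar int] to
   have the library's order on extended numbers. *)
Definition cu_dim : \bar int :=
  match pselect (exists n, `[< cu_dim_le n >]) with
  | left h => ((ex_minn h)%:Z)%:E
  | right _ => +oo%E
  end.

End CuSemigroups.

Arguments cu_semigroup {d} S.
Arguments countably_based {d} S.
Arguments cu_dim {d} S.

Record cu_morphism (d d' : Order.disp_t)
    (M : porderNmodType d) (N : porderNmodType d') (f : M -> N) : Prop :=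
    CuMorphism {
  cu_morD : nmod_morphism f;
  cu_mor_le : {homo f : x y / (x <= y)%O};
  cu_mor_sup : forall (u : nat -> M) (s : M),
    increasing u -> is_sup u s -> is_sup (f \o u) (f s);
  cu_mor_wb : forall x y : M, way_below x y -> way_below (f x) (f y) }.

(* A submonoid of [S] is a [T : addrClosed S]; [subcu_type T] is its carrier
   with the induced addition and the induced order.  All notions applied to it,
   in particular [way_below], are computed inside [T]. *)
Section SubCu.
Variables (d : Order.disp_t) (S : porderNmodType d) (T : addrClosed S).

Definition subcu_type : Type := {x : S | x \in T}.

HB.instance Definition _ := SubChoice.on subcu_type.
HB.instance Definition _ :=
  GRing.SubChoice_isSubNmodule.Build S _ subcu_type (@rpred0D S T).
HB.instance Definition _ :=
  [SubChoice_isSubPOrder of subcu_type by <: with d].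
HB.instance Definition _ := POrderedNmodule.on subcu_type.

Definition sub_cu_semigroup : Prop :=
  cu_semigroup subcu_type /\ cu_morphism (val : subcu_type -> S).

End SubCu.

(* Main.v *)
From HB Require Import structures.
Require Import Defs.
From mathcomp Require Import all_boot all_order all_algebra.
From mathcomp Require Import boolp classical_sets cardinality constructive_ereal.

Set Implicit Arguments.
Unset Strict Implicit.
Unset Printing Implicit Defensive.
Import Order.TTheory GRing.Theory.

(** The proof is a downward Loewenheim-Skolem argument.  The semigroup [T] is
    recovered from a countable set [B] of elements of [S] as the set of those
    [x] that [B] approximates: whenever [x' << x], some [b] in [B] satisfies
    [x' << b << x].  Whatever [B] is, this set is closed under suprema of
    increasing sequences ([approximates_sup]), because an [x'] way below a
    supremum is already way below a member of the sequence.  If [B] is closed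
    under sums, so is [T] ([approximatesD]), and if [B] approximates its own
    elements, then [B] lies in [T] and every element of [T] is the supremum of a
    [<<]-increasing sequence in [B] ([approximates_seq]).  Closure under suprema
    and (O2) make [T] a sub-Cu-semigroup whose way-below relation is the one of
    [S] ([sub_cu_criterion]), and [B] is then a countable basis of it.

    The dimension of [T] can also be tested on [B] alone ([approximated_dim_le]):
    in [x' << x << y_1 + ... + y_r], there is room to replace [x'], [x] and the
    [y_j] by elements of [B], so that it suffices that [B] contains the
    witnesses required by configurations of elements of [B].

    What is left is to find such a [B].  All the demands have the same
    shape: a finite list of elements of [B] asks for countably many elements to
    be present (its sum, a sequence approximating its sum, finitely many
    dimension witnesses for each [n] with [dim S <= n]).  Closing the image of a
    countable basis of [T_0] under countably many answers to each finite list
    keeps it countable ([countable_closure]).  As [B] contains that image, [T]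
    contains [T_0] ([basis_approximates]). *)

(** * Countable closure *)

Section CountableClosure.
Local Open Scope classical_set_scope.

Lemma countableU (X : Type) (A B : set X) :
  countable A -> countable B -> countable (A `|` B).
Proof.
move=> A_count B_count; rewrite -bigcup2E.
by apply: bigcup_countable => [|[|[|n]] _] //=.
Qed.

Lemma countable_enum (X : choiceType) (x0 : X) (A : set X) :
  countable A -> exists a : nat -> X, A `<=` range a.
Proof.
move=> /countable_injP[f f_inj].
exists (fun n => xget x0 [set x | A x /\ f x = n]) => x Ax.
exists (f x) => //=; case: xgetP => [y _ [Ay fyx]|/(_ x)[]//].
by apply: f_inj; rewrite ?inE.
Qed.

(** Any family of demands indexed by finite lists, each of which countably many
    elements can meet, is met simultaneously by a countable set.  Answering each
    list with a sequence, the elements reachable from [A] are the values of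
    finite trees: a leaf names an element of [A], and a node with label [n] is
    the [n]-th answer to the list of values of its children.  There are only
    countably many trees. *)
Lemma countable_closure (X : choiceType) (x0 : X) (A : set X)
    (P : seq X -> set X -> Prop) :
  countable A ->
  (forall s C D, C `<=` D -> P s C -> P s D) ->
  (forall s, exists C, countable C /\ P s C) ->
  exists B, [/\ countable B, A `<=` B &
    forall s, {in s, forall x, B x} -> P s B].
Proof.
move=> A_count P_mono P_ex.
have [a Aa] := countable_enum x0 A_count.
have /choice[g Pg] : forall s, exists g : nat -> X, P s (range g).
  move=> s; have [C [C_count PC]] := P_ex s.
  by have [g Cg] := countable_enum x0 C_count; exists g; apply: P_mono Cg PC.
pose eval := fix eval t := match t with
  | GenTree.Leaf n => a n
  | GenTree.Node n ts => g (map eval ts) n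
  end.
exists (range eval); split.
- exact: (card_le_trans (card_image_le _ _) (countableP _)).
- by move=> _ /Aa[n _ <-]; exists (GenTree.Leaf n).
move=> s Bs.
have [ts sE] : exists ts, s = map eval ts.
  elim: s Bs => [|x s IHs] Bs; first by exists [::].
  have [t _ xE] := Bs x (mem_head x s).
  have [|ts sE] := IHs; first by move=> y ys; apply: Bs; rewrite inE ys orbT.
  by exists (t :: ts); rewrite /= xE -sE.
by rewrite sE; apply: P_mono (Pg _) => _ [n _ <-]; exists (GenTree.Node n ts).
Qed.

End CountableClosure.

(** * The way-below relation and approximation by a set *)

Section WayBelow.
Local Open Scope classical_set_scope.
Local Open Scope ring_scope.
Variables (d : Order.disp_t) (S : porderNmodType d).
Implicit Types (x y z : S) (u v : nat -> S) (B : set S).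

Lemma sup_ge u x n : is_sup u x -> (u n <= x)%O.
Proof. by case=> + _; apply; exists n. Qed.

Lemma sup_le u x y : is_sup u x -> (forall n, u n <= y)%O -> (x <= y)%O.
Proof. by case=> _ x_min uy; apply: x_min => _ [n _ <-]. Qed.

Lemma is_supI u x : (forall n, u n <= x)%O ->
  (forall y, (forall n, u n <= y)%O -> (x <= y)%O) -> is_sup u x.
Proof.
move=> ux x_min; split=> [_ [n _ <-]//|y uy].
by apply: x_min => n; apply: uy; exists n.
Qed.

Lemma is_sup_unique u x y : is_sup u x -> is_sup u y -> x = y.
Proof. exact: is_subset1_supremums. Qed.

Lemma le_wb_trans y x z : (x <= y)%O -> way_below y z -> way_below x z.
Proof.
move=> xy yz u s u_inc us zs; have [n yn] := yz u s u_inc us zs.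
by exists n; apply: le_trans yn.
Qed.

Lemma wb_le_trans y x z : way_below x y -> (y <= z)%O -> way_below x z.
Proof.
move=> xy yz u s u_inc us zs; apply: (xy u s) => //; exact: le_trans zs.
Qed.

Lemma wb_le x y : way_below x y -> (x <= y)%O.
Proof.
move=> xy; have [] // := xy (fun=> y) y _ _ (lexx y).
by apply: is_supI => // z /(_ 0).
Qed.

Lemma wb_trans y x z : way_below x y -> way_below y z -> way_below x z.
Proof. by move=> /wb_le; apply: le_wb_trans. Qed.

Lemma wb_increasing u : (forall n, way_below (u n) (u n.+1)) -> increasing u.
Proof.
move=> u_wb; apply: homo_leq => [x|y x z|n] //; first exact: le_trans.
exact: wb_le.
Qed.

Definition approximates B x :=
  forall x', way_below x' x -> exists b, [/\ B b, way_below x' b & way_below b x].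

Hypothesis cuS : cu_semigroup S.

Lemma leD x x' y y' : (x <= x' -> y <= y' -> x + y <= x' + y')%O.
Proof.
move=> xx' yy'; apply: le_trans (cu_leD2r cuS y xx') _.
by rewrite ![x' + _]addrC; apply: cu_leD2r.
Qed.

Lemma wb_interpolation x y :
  way_below x y -> exists z, way_below x z /\ way_below z y.
Proof.
have [u [u_wb uy]] := cu_O2 cuS y.
move=> /(_ u y (wb_increasing u_wb) uy (lexx y))[n xn].
exists (u n.+1); split; first exact: le_wb_trans xn (u_wb n).
exact: wb_le_trans (u_wb n.+1) (sup_ge _ uy).
Qed.

(** The sum of [<<]-increasing sequences with suprema [x] and [y] has supremum
    [x + y] by (O4), so it eventually exceeds an interpolant of [z << x + y]. *)
Lemma wb_add_split z x y : way_below z (x + y) ->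
  exists x' y', [/\ way_below x' x, way_below y' y & way_below z (x' + y')].
Proof.
move=> /wb_interpolation[w [zw wxy]].
have [u [u_wb ux]] := cu_O2 cuS x; have [v [v_wb vy]] := cu_O2 cuS y.
have [u_inc v_inc] := (wb_increasing u_wb, wb_increasing v_wb).
have [||n wn] := wxy (fun n => u n + v n) (x + y) _ (cu_O4 cuS u_inc v_inc ux vy).
- by move=> i j ij; apply: leD; [apply: u_inc|apply: v_inc].
- exact: lexx.
exists (u n), (v n); split; last exact: wb_le_trans zw wn.
- exact: wb_le_trans (u_wb n) (sup_ge _ ux).
- exact: wb_le_trans (v_wb n) (sup_ge _ vy).
Qed.

Lemma wb_sum_approx B r z (y : 'I_r -> S) :
  (forall j, approximates B (y j)) -> way_below z (\sum_(j < r) y j) ->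
  exists b : 'I_r -> S, [/\ forall j, B (b j), forall j, way_below (b j) (y j)
    & way_below z (\sum_(j < r) b j)].
Proof.
elim: r z y => [|r IHr] z y By zy.
  by exists (fun=> 0); split=> [[]|[]|] //; move: zy; rewrite !big_ord0.
move: zy; rewrite big_ord_recl => /wb_add_split[y0 [y1 [/By[b0 [Bb0 y0b0 b0y]]]]].
move=> /IHr[//|b [Bb by_ y1b]] zy.
exists (fun j => oapp b b0 (unlift ord0 j)); split.
- by move=> j; case: unliftP => [j' _|_] /=.
- by move=> j; case: unliftP => [j' ->|->] /=.
rewrite big_ord_recl unlift_none /=; under eq_bigr do rewrite liftK /=.
by apply: wb_le_trans zy _; apply: leD; apply: wb_le.
Qed.

Lemma approximates_sup B u x : increasing u ->
  (forall n, approximates B (u n)) -> is_sup u x -> approximates B x.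
Proof.
move=> u_inc Bu ux x' /wb_interpolation[x'' [x'x'' x''x]].
have [n x''n] := x''x u x u_inc ux (lexx x).
have [b [Bb x'b bu]] := Bu n _ (wb_le_trans x'x'' x''n).
by exists b; split=> //; apply: wb_le_trans bu (sup_ge _ ux).
Qed.

Lemma approximatesD B x y : (forall b c, B b -> B c -> B (b + c)) ->
  approximates B x -> approximates B y -> approximates B (x + y).
Proof.
move=> BD Bx By z /wb_add_split[x' [y' [/Bx + /By + zxy]]].
move=> [b [Bb x'b bx]] [c [Bc y'c cy]].
exists (b + c); split; [exact: BD| |exact: cu_O3].
by apply: wb_le_trans zxy _; apply: leD; apply: wb_le.
Qed.

(** The sequence is built by dependent choice: given [u_n << x] in [B] and a
    [<<]-increasing sequence [v] with supremum [x], the next term is an element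
    of [B] below [x] and way above both [u_n] and [v_n]. *)
Lemma approximates_seq B x : approximates B x ->
  exists u, [/\ forall n, B (u n), forall n, way_below (u n) (u n.+1)
    & is_sup u x].
Proof.
move=> Bx; have [v [v_wb vx]] := cu_O2 cuS x.
have v_inc := wb_increasing v_wb.
have vn_x n : way_below (v n) x := wb_le_trans (v_wb n) (sup_ge _ vx).
have [b0 [Bb0 _ b0x]] := Bx _ (vn_x 0%N).
have /choice[f fP] : forall p : S * nat, exists b, B p.1 -> way_below p.1 x ->
    [/\ B b, way_below p.1 b, way_below (v p.2) b & way_below b x].
  case=> b n /=; have [[Bb bx]|nB] := pselect (B b /\ way_below b x); last first.
    by exists b => Bb bx; case: nB.
  have [m bm] := bx v x v_inc vx (lexx x).
  have [c [Bc mc cx]] := Bx _ (vn_x (maxn m n)).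
  exists c => _ _; split=> //; apply: le_wb_trans mc; last first.
    by apply: v_inc; apply: leq_maxr.
  by apply: le_trans bm _; apply: v_inc; apply: leq_maxl.
pose u := fix u n := if n is n'.+1 then f (u n', n') else b0.
have uP n : B (u n) /\ way_below (u n) x.
  by elim: n => [//|n [Bu ux]] /=; have [] := fP (u n, n) Bu ux.
exists u; split=> [n|n|]; first by case: (uP n).
  by have [Bu ux] := uP n; have [] := fP (u n, n) Bu ux.
apply: is_supI => [n|y uy]; first by apply: wb_le; case: (uP n).
apply: sup_le vx _ => n; apply: le_trans (uy n.+1).
by have [Bu ux] := uP n; apply: wb_le; have [] := fP (u n, n) Bu ux.
Qed.

End WayBelow.

(** * A criterion for sub-Cu-semigroups *)

Section SubCuCriterion.
Local Open Scope classical_set_scope.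
Local Open Scope ring_scope.
Variables (d : Order.disp_t) (S : porderNmodType d) (T : addrClosed S).
Local Notation sT := (subcu_type T).
Implicit Types (x y : sT) (u : nat -> sT).

Lemma le_subcu x y : (x <= y)%O = (val x <= val y)%O.
Proof. by []. Qed.

Lemma subcu_is_sup u x : is_sup (val \o u) (val x) -> is_sup u x.
Proof.
move=> ux; apply: is_supI => [n|y uy]; rewrite le_subcu.
  exact: (sup_ge n ux).
by apply: sup_le ux _ => n; rewrite /= -le_subcu.
Qed.

Hypothesis cuS : cu_semigroup S.
Hypothesis T_sup : forall (u : nat -> S) s,
  increasing u -> (forall n, u n \in T) -> is_sup u s -> s \in T.
Hypothesis T_O2 : forall x : S, x \in T -> exists u : nat -> S,
  [/\ forall n, u n \in T, forall n, way_below (u n) (u n.+1) & is_sup u x].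

(** The supremum computed in [S] lies in [T], so it is the supremum in [T]. *)
Lemma val_is_sup u x : increasing u -> is_sup u x -> is_sup (val \o u) (val x).
Proof.
move=> u_inc ux.
have vu_inc : increasing (val \o u) by move=> i j ij; apply: u_inc.
have [s us] := cu_O1 cuS vu_inc.
have Ts : s \in T by apply: T_sup vu_inc _ us => n; apply: valP.
rewrite (is_sup_unique ux (y := (Sub s Ts : sT))) ?SubK //.
exact: subcu_is_sup.
Qed.

(** The direct implication is where (O2) inside [T] is used: [y] is the supremum
    of a sequence of [T] that is [<<]-increasing for [S], and [x] lies below one
    of its terms. *)
Lemma subcu_way_below x y : way_below x y <-> way_below (val x) (val y).
Proof.
split=> [xy|xy u s u_inc us ys]; last first.
  exact: (xy (val \o u) (val s) u_inc (val_is_sup u_inc us)).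
have [u [Tu u_wb uy]] := T_O2 (valP y).
pose u' n : sT := Sub (u n) (Tu n).
have u'_inc : increasing u' by move=> i j ij; apply: (wb_increasing u_wb ij).
have [|n xn] := xy u' y u'_inc _ (lexx y); first exact: subcu_is_sup.
apply: (wb_le_trans _ (sup_ge n.+1 uy)).
exact: le_wb_trans (xn : (val x <= u n)%O) (u_wb n).
Qed.

Lemma sub_cu_criterion : sub_cu_semigroup T.
Proof.
split; split=> //.
- by move=> x; apply: (cu_ge0 cuS).
- by move=> x y z xy; apply: (cu_leD2r cuS).
- move=> u u_inc.
  have vu_inc : increasing (val \o u) by move=> i j ij; apply: u_inc.
  have [s us] := cu_O1 cuS vu_inc.
  have Ts : s \in T by apply: T_sup vu_inc _ us => n; apply: valP.
  by exists (Sub s Ts : sT); apply: subcu_is_sup.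
- move=> x; have [u [Tu u_wb ux]] := T_O2 (valP x).
  exists (fun n => Sub (u n) (Tu n) : sT); split=> [n|].
    by apply/subcu_way_below; rewrite !SubK.
  exact: subcu_is_sup.
- move=> x' x y' y /subcu_way_below xx /subcu_way_below yy.
  by apply/subcu_way_below; apply: (cu_O3 cuS xx yy).
- move=> u v s t u_inc v_inc us vt; apply: subcu_is_sup.
  exact: (cu_O4 cuS u_inc v_inc (val_is_sup u_inc us) (val_is_sup v_inc vt)).
- exact: val_is_sup.
- by move=> x y /subcu_way_below.
Qed.

End SubCuCriterion.

Section SubmonoidOfPredicate.
Local Open Scope ring_scope.

Lemma exists_addrClosed (V : nmodType) (P : V -> Prop) :
  P 0 -> (forall x y, P x -> P y -> P (x + y)) ->
  exists T : addrClosed V, forall x, x \in T <-> P x.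
Proof.
move=> P0 PD; pose p : {pred V} := fun x => `[< P x >].
have p_closed : Algebra.nmod_closed p.
  by split=> [|x y /asboolP Px /asboolP Py]; apply/asboolP; [|apply: PD].
pose pA := GRing.isAddClosed.Build V p p_closed.
pose T : addrClosed V := HB.pack p pA.
by exists T => x; split=> [/asboolP|Px] //; apply/asboolP.
Qed.

End SubmonoidOfPredicate.

(** * Dimension witnesses *)

Section DimensionWitnesses.
Local Open Scope classical_set_scope.
Local Open Scope ring_scope.
Variables (d : Order.disp_t) (S : porderNmodType d).

(** The demand that the definition of dimension makes of one configuration
    [x' << x << y_1 + ... + y_r], with the witnesses confined to [C]. *)
Definition dim_task n (C : set S) (x' x : S) r (y : 'I_r -> S) : Prop :=
  (0 < r)%N -> way_below x' x -> way_below x (\sum_(j < r) y j) ->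
  exists z : 'I_r -> 'I_n.+1 -> S,
    [/\ forall j k, C (z j k) /\ way_below (z j k) (y j),
        way_below x' (\sum_(j < r) \sum_(k < n.+1) z j k)
      & forall k, way_below (\sum_(j < r) z j k) x].

(** The same demand, with the configuration packed into a sequence: this is the
    form in which the countable closure consumes it. *)
Definition dim_task_seq n (C : set S) (s : seq S) : Prop :=
  if s is [:: x', x & t] then dim_task n C x' x (tnth (in_tuple t)) else True.

(** Unpacking needs a transport: [r] equals [size y] only propositionally. *)
Lemma dim_task_seqE n C x' x r (y : r.-tuple S) :
  dim_task_seq n C [:: x', x & y] -> dim_task n C x' x (tnth y).
Proof.
case: y => y /= y_size; case: _ / (eqP y_size) (y_size) => y_size'.
by rewrite (_ : Tuple _ = in_tuple y) //; apply: val_inj.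
Qed.

Lemma dim_task_seq_sub n (C D : set S) s :
  C `<=` D -> dim_task_seq n C s -> dim_task_seq n D s.
Proof.
move=> CD; case: s => [|x' [|x t]] //= Ct t0 x'x xt.
have [z [Cz x'z zx]] := Ct t0 x'x xt.
by exists z; split=> // j k; have [/CD Dz zy] := Cz j k.
Qed.

Lemma exists_dim_task_seq n s : cu_dim_le S n ->
  exists C, countable C /\ dim_task_seq n C s.
Proof.
move=> dimS; case: s => [|x' [|x t]]; [by exists set0; split..|].
have [[t0 x'x xt]|no_task] := pselect [/\ (0 < size t)%N, way_below x' x
    & way_below x (\sum_(j < size t) tnth (in_tuple t) j)]; last first.
  by exists set0; split=> // t0 x'x xt; case: no_task.
have [z [zt x'z zx]] := dimS _ _ _ _ t0 x'x xt.
exists (range (fun p => z p.1 p.2)); split.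
  exact: (card_le_trans (card_image_le _ _) (countableP _)).
by exists z; split=> // j k; split=> //; exists (j, k).
Qed.

End DimensionWitnesses.

(** * The subsemigroup approximated by a set *)

Section ApproximatedSubsemigroup.
Local Open Scope classical_set_scope.
Local Open Scope ring_scope.
Variables (d : Order.disp_t) (S : porderNmodType d) (B : set S).
Hypothesis cuS : cu_semigroup S.

Variable T : addrClosed S.
Hypothesis T_approx : forall x, x \in T <-> approximates B x.
Hypothesis B_approx : forall b, B b -> approximates B b.
Local Notation sT := (subcu_type T).

Let T_sup (u : nat -> S) s :
  increasing u -> (forall n, u n \in T) -> is_sup u s -> s \in T.
Proof.
move=> u_inc Tu us; apply/T_approx; apply: approximates_sup us => // n.
exact/T_approx.
Qed.

Let T_O2 (x : S) : x \in T -> exists u : nat -> S,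
  [/\ forall n, u n \in T, forall n, way_below (u n) (u n.+1) & is_sup u x].
Proof.
move=> /T_approx/(approximates_seq cuS)[u [Bu u_wb ux]].
by exists u; split=> // n; apply/T_approx/B_approx.
Qed.

Let wbE (x y : sT) : way_below x y <-> way_below (val x) (val y).
Proof. exact: subcu_way_below. Qed.

Let approx_val (x : sT) : approximates B (val x).
Proof. by apply/T_approx; apply: valP. Qed.

Lemma approximated_sub_cu : sub_cu_semigroup T.
Proof. exact: sub_cu_criterion. Qed.

Lemma approximated_countably_based : countable B -> countably_based sT.
Proof.
move=> /countable_injP[f f_inj].
exists [set x : sT | B (val x)]; split.
  apply/countable_injP; exists (f \o val) => x y; rewrite !inE => Bx By fxy.
  by apply/val_inj/f_inj; rewrite ?inE.
move=> x' x /wbE/approx_val[b [Bb x'b bx]].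
have Tb : b \in T by apply/T_approx/B_approx.
by exists (Sub b Tb : sT); split=> //; apply/wbE.
Qed.

(** Replacing [x' << x << y_1 + ... + y_r] in [T] by
    [b' << b << c_1 + ... + c_r] in [B], with [x' << b' << b << x] and
    [c_j << y_j], only makes the requirements on the witnesses stronger. *)
Lemma approximated_dim_le n :
  (forall s : seq S, {in s, forall x, B x} -> dim_task_seq n B s) ->
  cu_dim_le sT n.
Proof.
move=> B_dim r x' x y r0 /wbE/approx_val[b [Bb x'b bx]] /wbE xy.
have [b' [Bb' x'b' b'b]] := B_approx Bb x'b.
rewrite raddf_sum in xy.
have [c [Bc cy xc]] := wb_sum_approx cuS (fun j => @approx_val (y j)) xy.
have task_in : {in [:: b', b & [tuple c j | j < r]], forall x, B x}.
  by move=> w; rewrite !inE => /or3P[/eqP->|/eqP->|/mapP[j _ ->]].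
have [|z [zc b'z zb]] := dim_task_seqE (B_dim _ task_in) r0 b'b.
  apply: wb_trans bx _; under eq_bigr do rewrite tnth_mktuple; exact: xc.
have Tz j k : z j k \in T by apply/T_approx/B_approx; case: (zc j k).
exists (fun j k => Sub (z j k) (Tz j k) : sT); split.
- move=> j k; apply/wbE; have [_] := zc j k; rewrite tnth_mktuple SubK => zcj.
  exact: wb_trans zcj (cy j).
- apply/wbE; rewrite raddf_sum; apply: wb_trans x'b' _.
  by under eq_bigr do rewrite raddf_sum /=.
- move=> k; apply/wbE; rewrite raddf_sum.
  exact: wb_trans (zb k) bx.
Qed.

End ApproximatedSubsemigroup.

(** * A countable set meeting all demands *)

Section CountableApproximatingSets.
Local Open Scope classical_set_scope.
Local Open Scope ring_scope.
Variables (d : Order.disp_t) (S : porderNmodType d).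
Hypothesis cuS : cu_semigroup S.

Lemma exists_countable_approximation (x : S) :
  exists C, countable C /\ approximates C x.
Proof.
have [u [u_wb ux]] := cu_O2 cuS x.
exists (range u); split.
  exact: (card_le_trans (card_image_le _ _) (countableP _)).
move=> x' /(wb_interpolation cuS)[w [x'w wx]].
have [n wn] := wx u x (wb_increasing u_wb) ux (lexx x).
exists (u n); split; [by exists n|exact: wb_le_trans wn|].
exact: wb_le_trans (u_wb n) (sup_ge _ ux).
Qed.

Lemma approximates_sub (C D : set S) x :
  C `<=` D -> approximates C x -> approximates D x.
Proof.
by move=> CD Cx x' /Cx[b [/CD Db x'b bx]]; exists b.
Qed.

Lemma countable_approximated_closure (A : set S) : countable A ->
  exists B, [/\ countable B, A `<=` B,
    B 0 /\ (forall x y, B x -> B y -> B (x + y)),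
    forall b, B b -> approximates B b &
    forall n, cu_dim_le S n ->
      forall s : seq S, {in s, forall x, B x} -> dim_task_seq n B s].
Proof.
move=> A_count.
(* The empty list yields 0, lists of length 1 the approximation of an
   element, and lists of length 2 the closure under addition. *)
pose P (s : seq S) (C : set S) := [/\ C (\sum_(x <- s) x),
  approximates C (\sum_(x <- s) x)
  & forall n, cu_dim_le S n -> dim_task_seq n C s].
have [|s|B [B_count AB PB]] := countable_closure 0 (P := P) A_count.
- move=> s C D CD [Cs C_approx C_dim]; split; first exact: CD.
  + exact: approximates_sub C_approx.
  + by move=> n /C_dim; apply: dim_task_seq_sub.
- have [C [C_count C_approx]] := exists_countable_approximation (\sum_(x <- s) x).
  have /choice[W WP] : forall n, exists W, countable W /\
      (cu_dim_le S n -> dim_task_seq n W s).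
    move=> n; have [/(exists_dim_task_seq s)[W [W_count Ws]]|nS] :=
      pselect (cu_dim_le S n); first by exists W.
    by exists set0; split=> //; apply: countable0.
  exists (\sum_(x <- s) x |` (C `|` \bigcup_n W n)); split.
    apply: countableU; first exact: countable1.
    apply: countableU => //; apply: bigcup_countable; first exact: countableP.
    by move=> n _; case: (WP n).
  split; first by left.
  + by apply: approximates_sub C_approx => x Cx; right; left.
  + move=> n nS; apply: dim_task_seq_sub (proj2 (WP n) nS) => x Wx.
    by right; right; exists n.
have Bseq1 b : B b -> {in [:: b], forall x, B x}.
  by move=> Bb x; rewrite inE => /eqP ->.
exists B; split=> //.
- split=> [|x y Bx By].
    by have [|] := PB [::]; rewrite ?big_nil.
  have [|+ _ _] := PB [:: x; y]; last by rewrite big_cons big_seq1.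
  by move=> z; rewrite !inE => /orP[]/eqP ->.
- by move=> b /Bseq1/PB[_ + _]; rewrite big_seq1.
- by move=> n nS s /PB[_ _]; apply.
Qed.

End CountableApproximatingSets.

(** * The theorem *)

Lemma basis_approximates (d d' : Order.disp_t) (S : porderNmodType d)
    (T : porderNmodType d') (f : T -> S) (B : set T) (x : T) :
  cu_semigroup S -> cu_semigroup T -> cu_morphism f -> is_basis B ->
  approximates (image B f) (f x).
Proof.
move=> cuS cuT f_cu B_basis x' /(wb_interpolation cuS)[w [x'w wx]].
have [u [u_wb ux]] := cu_O2 cuT x.
have fu_inc : increasing (f \o u).
  by move=> i j ij; apply/(cu_mor_le f_cu)/(wb_increasing u_wb).
have [n wn] := wx (f \o u) (f x) fu_inc
  (cu_mor_sup f_cu (wb_increasing u_wb) ux) (lexx _).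
have [b [Bb ub bu]] := B_basis _ _ (u_wb n).
exists (f b); split; first by exists b.
- apply: wb_trans x'w _; apply: le_wb_trans wn _; exact: (cu_mor_wb f_cu ub).
- exact: (cu_mor_wb f_cu (wb_le_trans bu (sup_ge _ ux))).
Qed.

Lemma cu_dim_le_from_bounds (d d' : Order.disp_t) (S : porderNmodType d)
    (T : porderNmodType d') :
  (forall n, cu_dim_le S n -> cu_dim_le T n) -> (cu_dim T <= cu_dim S)%E.
Proof.
move=> ST; rewrite /cu_dim.
case: pselect => [exT|nexT]; case: pselect => [exS|nexS].
- case: ex_minnP => m _ m_min; case: ex_minnP => n /asboolP/ST nT _.
  by rewrite lee_fin; apply: m_min; apply/asboolP.
- exact: leey.
- by case: nexT; case: exS => n /asboolP/ST nT; exists n; apply/asboolP.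
- exact: leey.
Qed.

Theorem lemma5p5 (d : Order.disp_t) (S : porderNmodType d) (T0 : addrClosed S) :
  cu_semigroup S ->
  sub_cu_semigroup T0 -> countably_based (subcu_type T0) ->
  exists T : addrClosed S,
    [/\ sub_cu_semigroup T, countably_based (subcu_type T),
        {subset T0 <= T} & (cu_dim (subcu_type T) <= cu_dim S)%E].
Proof.
move=> cuS [cuT0 T0_incl] [B0 [B0_count B0_basis]].
have B0val_count : countable (image B0 val).
  exact: (card_le_trans (card_image_le _ _) B0_count).
have [B [B_count B0B [B_0 BD] B_approx B_dim]] :=
  countable_approximated_closure cuS B0val_count.
have [||T T_approx] := @exists_addrClosed S (approximates B).
- exact: B_approx.
- by move=> x y; apply: approximatesD.
exists T; split.
- exact (approximated_sub_cu cuS T_approx B_approx).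
- exact (approximated_countably_based cuS T_approx B_approx B_count).
- move=> x T0x; apply/T_approx.
  apply: (approximates_sub B0B); rewrite -(SubK (subcu_type T0) T0x).
  exact: basis_approximates.
- apply: cu_dim_le_from_bounds => n nS.
  exact (approximated_dim_le cuS T_approx B_approx (B_dim n nS)).
Qed.
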